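(* For every co-bipartite graph $G$, the following are equivalent: (1) $G$ is $1$-perfectly orientable; (2) $G$ has an orientation in which every induced $4$-cycle is oriented cyclically; (3) $G$ is a circular arc graph.
   Context: All graphs are finite and simple. A graph is co-bipartite if its complement is bipartite. An orientation of a graph $G$ is $1$-perfect if for every vertex $v$, its out-neighborhood is a clique in $G$; $G$ is $1$-perfectly orientable if it admits a $1$-perfect orientation. A cycle of $G$ is oriented cyclically in an orientation if each of its vertices has exactly one out-neighbor on the cycle. A circular arc graph is the intersection graph of a finite family of closed arcs on a circle. *)

(* Defs.v *)
From mathcomp Require Import all_boot all_order all_algebra.
From mathcomp Require Import classical_sets reals trigo.

Set Implicit Arguments.
Unset Strict Implicit.
Unset Printing Implicit Defensive.

Section Graphs.
Variable T : finType.
Implicit Types (e d : rel T) (A : {set T}) (c : seq T).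

(* A finite simple graph is given by its adjacency relation on a finType. *)
Definition simple_graph e : Prop := symmetric e /\ irreflexive e.

Definition complement e : rel T := fun x y => (x != y) && ~~ e x y.

Definition bipartite e : Prop :=
  exists A, forall x y, e x y -> (x \in A) != (y \in A).

Definition co_bipartite e : Prop := bipartite (complement e).

Definition clique e A : Prop := {in A &, forall x y, x != y -> e x y}.

(* [d x y] means that the edge xy is directed from x to y; the exclusive or
   (+) says that each edge gets exactly one of its two directions. *)
Definition orientation e d : Prop :=
  (forall x y, d x y -> e x y) /\ (forall x y, e x y -> d x y (+) d y x).

Definition one_perfect e d : Prop :=
  orientation e d /\ forall v, clique e [set w | d v w].

Definition one_perfectly_orientable e : Prop := exists d, one_perfect e d.

(* A cycle is the cyclic sequence [c] of its (distinct) vertices. It is induced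
   when every edge of the graph between two of its vertices is one of its own
   edges, i.e. joins consecutive vertices. *)
Definition induced_cycle e c : Prop :=
  [/\ 2 < size c, ucycle e c &
      {in c &, forall x y, e x y -> (y == next c x) || (x == next c y)}].

Definition cyclically_oriented d c : Prop :=
  {in c, forall x, #|[set y in c | d x y]| = 1}.

Definition induced_C4_cyclically_orientable e : Prop :=
  exists d, orientation e d /\
    forall c, induced_cycle e c -> size c = 4 -> cyclically_oriented d c.

End Graphs.

Section CircularArc.
Local Open Scope ring_scope.
Local Open Scope classical_set_scope.
Variable R : realType.

Definition circle_point (t : R) : R * R := (cos t, sin t).

(* The closed arcs of the unit circle: images of compact intervals of angles.
   Arcs are nonempty; single points (a = b) and the full circle
   (b - a >= 2 pi) are allowed, which does not change the class of
   intersection graphs of finite families. *)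
Definition closed_arc (S : set (R * R)) : Prop :=
  exists a b : R, a <= b /\ S = circle_point @` [set t | a <= t <= b].

Definition circular_arc_graph (T : finType) (e : rel T) : Prop :=
  exists S : T -> set (R * R),
    (forall x, closed_arc (S x)) /\
    (forall x y, x != y -> (e x y <-> S x `&` S y !=set0)).

End CircularArc.

(* Main.v *)
Require Import Defs.
From mathcomp Require Import all_boot all_order all_algebra.
From mathcomp Require Import zify.

(* Let A and B be the two cliques. An induced 4-cycle consists of two vertices of
   A, two of B, and two cross edges; orienting it cyclically forces these two
   conflicting cross edges to go in opposite directions between A and B. So
   condition (2) yields a proper 2-colouring of the conflict graph on the cross
   edges, and the main point is that the bipartite graph H of cross edges is then
   a union of two chain graphs (Cogis; Ibaraki and Peled). Given two such chain
   graphs, arcs of A around angle 0 and arcs of B around angle pi realise one of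
   them on each side of the circle.

   For a colouring c, the edges in no conflict with an edge of colour x form a
   chain graph for both colours x, unless some 6-cycle of H with missing long
   diagonals alternates in colour. To avoid such hexagons, let the colour of a
   component of the conflict graph be decided by which of its two colour classes
   has the smaller least A-endpoint. Each A-vertex of an alternating hexagon lies
   on two of its edges, and the classes of these two edges have the same set of
   A-endpoints (hexagon_class); the three sets so obtained are pairwise disjoint,
   and their minima would increase cyclically. *)

Set Implicit Arguments.
Unset Strict Implicit.
Unset Printing Implicit Defensive.

(** * Conflict graph of a bipartite graph and alternating hexagons *)

Section TwoChains.
Variables (U V : finType) (H : U -> V -> bool).
Implicit Types (f g h : U * V) (c : pred (U * V)).

Definition conflict f g :=
  [&& H f.1 f.2, H g.1 g.2, ~~ H f.1 g.2 & ~~ H g.1 f.2].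

Definition proper_colouring c := forall f g, conflict f g -> c f = ~~ c g.

Lemma conflict_sym : symmetric conflict.
Proof. by move=> f g; rewrite /conflict andbCA [~~ _ && _]andbC. Qed.

(** The 6-cycle a0 b1 a2 b0 a1 b2, whose long diagonals are the missing pairs ai bi. Opposite edges
    conflict, so for a proper [c] the three equal colours recorded here give the other three edges
    the opposite colour. *)
Definition hexagon c a0 a1 a2 b0 b1 b2 : Prop :=
  [/\ [&& ~~ H a0 b0, ~~ H a1 b1 & ~~ H a2 b2],
      [&& H a0 b1, H a1 b2 & H a2 b0],
      [&& H a0 b2, H a1 b0 & H a2 b1] &
      c (a0, b1) = c (a1, b2) /\ c (a1, b2) = c (a2, b0)].

Lemma hexagon_rot c a0 a1 a2 b0 b1 b2 :
  hexagon c a0 a1 a2 b0 b1 b2 -> hexagon c a1 a2 a0 b1 b2 b0.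
Proof.
case=> /and3P[n0 n1 n2] /and3P[h01 h12 h20] /and3P[h02 h10 h21] [c1 c2].
by split; rewrite ?n0 ?n1 ?n2 ?h01 ?h12 ?h20 ?h02 ?h10 ?h21 // c1 c2.
Qed.

Section Proper.
Variables (c : pred (U * V)) (c_proper : proper_colouring c).

Lemma hexagon_flip a0 a1 a2 b0 b1 b2 :
  hexagon c a0 a1 a2 b0 b1 b2 -> hexagon c a0 a2 a1 b0 b2 b1.
Proof.
case=> /and3P[n0 n1 n2] /and3P[h01 h12 h20] /and3P[h02 h10 h21] [c1 c2].
split; rewrite ?n0 ?n1 ?n2 ?h01 ?h12 ?h20 ?h02 ?h10 ?h21 //.
have -> : c (a0, b2) = ~~ c (a2, b0).
  by apply: c_proper; rewrite /conflict /= h02 h20 n0 n2.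
have -> : c (a2, b1) = ~~ c (a1, b2).
  by apply: c_proper; rewrite /conflict /= h21 h12 n1 n2.
have -> : c (a1, b0) = ~~ c (a0, b1).
  by apply: c_proper; rewrite /conflict /= h10 h01 n1 n0.
by rewrite c1 c2.
Qed.

Lemma hexagon_colour a0 a1 a2 b0 b1 b2 :
  hexagon c a0 a1 a2 b0 b1 b2 -> c (a0, b2) = ~~ c (a0, b1).
Proof.
case=> /and3P[n0 n1 n2] /and3P[h01 h12 h20] /and3P[h02 h10 h21] [-> ->].
by apply: c_proper; rewrite /conflict /= h02 h20 n0 n2.
Qed.

Lemma hexagon_swap a0 a1 a2 b0 b1 b2 :
  hexagon c a0 a1 a2 b0 b1 b2 -> hexagon c a1 a0 a2 b1 b0 b2.
Proof. by move/hexagon_flip/hexagon_rot/hexagon_rot. Qed.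

Lemma hexagon_move a0 a1 a2 b0 b1 b2 x y :
    hexagon c a0 a1 a2 b0 b1 b2 -> conflict (x, y) (a1, b0) ->
  hexagon c x a1 a2 b0 y b2.
Proof.
case=> /and3P[n0 n1 n2] /and3P[h01 h12 h20] /and3P[h02 h10 h21] [c1 c2] K.
have cxy : c (x, y) = c (a0, b1).
  rewrite (c_proper K) [in RHS](@c_proper _ (a1, b0)) //.
  by rewrite /conflict /= h01 h10 n0 n1.
case/and4P: K => /= hxy _ nx0 n1y.
have hx2 : H x b2.
  apply/negPn/negP => nx2; have := @c_proper (x, y) (a1, b2).
  by rewrite /conflict /= hxy h12 nx2 n1y cxy c1 => /(_ isT); case: (c _).
have h2y : H a2 y.
  apply/negPn/negP => n2y; have := @c_proper (x, y) (a2, b0).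
  by rewrite /conflict /= hxy h20 n2y nx0 cxy c1 c2 => /(_ isT); case: (c _).
by split; rewrite ?nx0 ?n1y ?n2 ?hxy ?h12 ?h20 ?hx2 ?h10 ?h2y // cxy.
Qed.

End Proper.

(** * Colour classes of the conflict components, and a colouring without alternating hexagons *)

Definition two_step f h := [exists g, conflict f g && conflict g h].
Notation same_class := (connect two_step).

Lemma two_step_sym : symmetric two_step.
Proof.
by move=> f h; apply: eq_existsb => g; rewrite andbC !(conflict_sym g).
Qed.

Lemma same_class_sym f h : same_class f h = same_class h f.
Proof. exact/sym_connect_sym/two_step_sym. Qed.

Lemma two_step_colour c f h : proper_colouring c -> two_step f h -> c f = c h.
Proof.
by move=> cP /existsP[g /andP[/cP-> /cP->]]; rewrite negbK.
Qed.

(** [same_class] joins edges by conflict walks of even length, along which a proper colour returns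
    to itself. *)
Lemma same_class_colour c f h :
  proper_colouring c -> same_class f h -> c f = c h.
Proof.
move=> cP /connectP[p]; elim: p f => [|g p IH] f /=; first by move=> _ ->.
by case/andP=> /(two_step_colour cP)-> /IH.
Qed.

(** The hexagon is moved along the walk from a0b1 to xy while a2 and b2 stay fixed. At each double
    step through uv, the edge a2v conflicts with both a0b2 and a0'b2. *)
Lemma hexagon_class c a0 a1 a2 b0 b1 b2 x y :
    proper_colouring c -> hexagon c a0 a1 a2 b0 b1 b2 ->
  same_class (a0, b1) (x, y) -> same_class (a0, b2) (x, b2).
Proof.
move=> cP hex /connectP[p].
elim: p a0 a1 b0 b1 hex => [|[a0' b1'] p IH] a0 a1 b0 b1 hex /=.
  by move=> _ [-> _].
case/andP=> /existsP[[u v] /andP[K1 K2]] path_p last_p.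
have hex1 : hexagon c a0 u a2 v b1 b2.
  apply/(hexagon_swap cP)/(hexagon_move cP (hexagon_swap cP hex)).
  by rewrite conflict_sym.
have hex2 : hexagon c a0' u a2 v b1' b2.
  by apply: (hexagon_move cP hex1); rewrite conflict_sym.
apply: connect_trans (IH _ _ _ _ hex2 path_p last_p); apply: connect1.
case: hex1 hex2 => [/and3P[n1 _ n2] /and3P[_ _ h1] /and3P[h2 _ _] _].
case=> [/and3P[n3 _ _] _ /and3P[h3 _ _] _].
by apply/existsP; exists (a2, v); rewrite /conflict /= n1 n2 n3 h1 h2 h3.
Qed.

Definition class_min f : nat :=
  enum_rank [arg min_(h < f | same_class f h) (enum_rank h.1 : nat)].1.

Lemma class_minP f :
  (exists2 h, same_class f h & class_min f = enum_rank h.1) /\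
  (forall h, same_class f h -> class_min f <= enum_rank h.1).
Proof.
rewrite /class_min; case: arg_minnP => [|h fh h_min]; first exact: connect0.
by split=> //; exists h.
Qed.

Lemma class_min_eq f h : same_class f h -> class_min f = class_min h.
Proof.
wlog suff le_min : f h / same_class f h -> class_min f <= class_min h.
  move=> fh; apply/eqP; rewrite eqn_leq !le_min //.
  by rewrite same_class_sym.
have [[g hg ->] _] := class_minP h; move=> fh.
by have [_] := class_minP f; apply; apply: connect_trans hg.
Qed.

Lemma hexagon_class_min c a0 a1 a2 b0 b1 b2 :
    proper_colouring c -> hexagon c a0 a1 a2 b0 b1 b2 ->
  class_min (a0, b1) = class_min (a0, b2).
Proof.
move=> cP; wlog suff le_min : a1 a2 b1 b2 / hexagon c a0 a1 a2 b0 b1 b2 ->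
    class_min (a0, b2) <= class_min (a0, b1).
  move=> hex; apply/eqP; rewrite eqn_leq (le_min _ _ _ _ hex).
  by rewrite (le_min _ _ _ _ (hexagon_flip cP hex)).
move=> hex; have [[[x y] cl_xy ->] _] := class_minP (a0, b1).
have [_ le_min] := class_minP (a0, b2).
exact: (le_min (x, b2) (hexagon_class cP hex cl_xy)).
Qed.

(** A common least endpoint x would put both a0b2 and a1b2 in the class of x b2, although these two
    edges differ in colour. *)
Lemma hexagon_class_min_neq c a0 a1 a2 b0 b1 b2 :
    proper_colouring c -> hexagon c a0 a1 a2 b0 b1 b2 ->
  class_min (a0, b1) != class_min (a1, b0).
Proof.
move=> cP hex; apply/eqP.
have [[[x y] cl0 ->] _] := class_minP (a0, b1).
have [[[x' y'] cl1 ->] _] := class_minP (a1, b0).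
move=> /val_inj/enum_rank_inj /= eq_x; rewrite -{}eq_x in cl1.
have := hexagon_class cP hex cl0.
have := hexagon_class cP (hexagon_swap cP hex) cl1.
move=> /(same_class_colour cP) c1 /(same_class_colour cP).
rewrite -c1 (hexagon_colour cP hex); case: hex => _ _ _ [-> _].
by case: (c _).
Qed.

(* The parity term c f prevents ties between conflicting edges. *)
Definition class_weight c f := (class_min f).*2 + c f.

Definition lex_colouring c : pred (U * V) := fun f =>
  [exists g, conflict f g && (class_weight c f < class_weight c g)].

(** All edges in conflict with [f] lie in one class and so have equal weight; any one of them
    decides the existential. *)
Lemma lex_colouringE c f g : proper_colouring c -> conflict f g ->
  lex_colouring c f = (class_weight c f < class_weight c g).
Proof.
move=> cP fg; apply/existsP/idP => [[h /andP[fh]]|fg_lt]; last first.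
  by exists g; rewrite fg.
suff -> : class_weight c h = class_weight c g by [].
have hg : same_class h g.
  by apply: connect1; apply/existsP; exists f; rewrite conflict_sym fh.
by rewrite /class_weight (class_min_eq hg) (same_class_colour cP hg).
Qed.

Lemma lex_colouring_proper c :
  proper_colouring c -> proper_colouring (lex_colouring c).
Proof.
move=> cP f g fg; rewrite (lex_colouringE cP fg).
rewrite conflict_sym in fg; rewrite (lex_colouringE cP fg).
by rewrite /class_weight (cP _ _ fg); case: (c f); lia.
Qed.

Lemma lex_colouring_hexagon c a0 a1 a2 b0 b1 b2 :
  proper_colouring c -> ~ hexagon (lex_colouring c) a0 a1 a2 b0 b1 b2.
Proof.
move=> cP; have lP := lex_colouring_proper cP.
(* The colour of x0y1 compares it with the conflicting x1y0; their minima differ, and x1y0 and x1y2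
   share theirs. *)
have step x0 x1 x2 y0 y1 y2 : hexagon (lex_colouring c) x0 x1 x2 y0 y1 y2 ->
    lex_colouring c (x0, y1) -> class_min (x0, y1) < class_min (x1, y2).
  move=> hex l01; have := hexagon_class_min_neq lP hex.
  have := hexagon_class_min lP (hexagon_swap lP hex).
  case: hex l01 => /and3P[n0 n1 _] /and3P[h01 _ _] /and3P[_ h10 _] _.
  rewrite (@lex_colouringE _ _ (x1, y0) cP) /class_weight; last first.
    by rewrite /conflict /= h01 h10 n0 n1.
  by case: (c _); case: (c _); lia.
(* Flipping the hexagon exchanges its two colour triples. *)
wlog l01 : a1 a2 b1 b2 / lex_colouring c (a0, b1) => [Hw hex|hex].
  have [l01|nl01] := boolP (lex_colouring c (a0, b1)); first exact: Hw l01 hex.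
  by apply: Hw (hexagon_flip lP hex); rewrite (hexagon_colour lP hex).
have [_ _ _ [l12 l20]] := hex.
have := step _ _ _ _ _ _ hex l01.
have := step _ _ _ _ _ _ (hexagon_rot hex).
have := step _ _ _ _ _ _ (hexagon_rot (hexagon_rot hex)).
by rewrite -l20 -l12 l01 => /(_ isT) ? /(_ isT) ?; lia.
Qed.

(** * Two chain graphs from a hexagon-free colouring *)

Definition half c x f :=
  H f.1 f.2 && [forall g, conflict f g ==> (c g != x)].

(** An edge of colour x conflicts only with edges of the other colour, hence lies in [half c x]; an
    edge in no conflict lies in both halves. *)
Lemma half_cover c f : proper_colouring c ->
  H f.1 f.2 = half c true f || half c false f.
Proof.
move=> cP; rewrite /half -andb_orr; case: (H _ _) => //=; symmetry.
case cf: (c f); apply/orP; [left|right]; apply/forallP => g; apply/implyP => fg.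
all: by have := cP _ _ fg; rewrite cf; case: (c g).
Qed.

Lemma half_chain c x a b a' b' :
    proper_colouring c ->
    (forall a0 a1 a2 b0 b1 b2, ~ hexagon c a0 a1 a2 b0 b1 b2) ->
  half c x (a, b) -> half c x (a', b') -> half c x (a, b') || half c x (a', b).
Proof.
move=> cP no_hex.
have colour_of f g : half c x f -> conflict f g -> c f = x.
  move=> /andP[_ /forallP/(_ g)/implyP nx] fg; move: (nx fg).
  by rewrite (cP _ _ fg); case: (c g); case: (x).
have no_conflict f g : half c x f -> conflict f g -> c g = x -> False.
  by move=> /andP[_ /forallP/(_ g)/implyP nx] /nx/eqP.
have conflict_of u v : H u v -> ~~ half c x (u, v) ->
    exists u' v', [/\ H u' v', ~~ H u v', ~~ H u' v & c (u', v') = x].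
  move=> huv; rewrite /half huv /= negb_forall => /existsP[[u' v']].
  rewrite negb_imply negbK => /andP[/and4P[/= _ h n1 n2] /eqP cx].
  by exists u', v'.
(* Otherwise uv, u'v' and a conflict of uv' span an alternating hexagon. *)
have one_missing u v u' v' : half c x (u, v) -> half c x (u', v') ->
    H u v' -> ~~ H u' v -> half c x (u, v').
  move=> huv huv' h12 n21; apply/negPn/negP => /(conflict_of _ _ h12).
  case=> u2 [v2 [h n1 n2 cx]].
  have h1 : H u v by case/andP: huv.
  have h2 : H u' v' by case/andP: huv'.
  have h3 : H u2 v.
    apply/negPn/negP => n3; apply: (no_conflict _ (u2, v2) huv) => //.
    by rewrite /conflict /= h1 h n1 n3.
  have h4 : H u' v2.
    apply/negPn/negP => n4; apply: (no_conflict _ (u2, v2) huv') => //.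
    by rewrite /conflict /= h2 h n4 n2.
  have c1 : c (u, v) = x.
    by apply: (colour_of _ (u', v2) huv); rewrite /conflict /= h1 h4 n1 n21.
  have c2 : c (u', v') = x.
    by apply: (colour_of _ (u2, v) huv'); rewrite /conflict /= h2 h3 n21 n2.
  apply: (no_hex u u' u2 v2 v v'); split; last by rewrite c1 c2 cx.
  1-3: by rewrite ?n1 ?n21 ?n2 ?h1 ?h2 ?h3 ?h4 ?h ?h12.
move=> hab hab'; apply/negPn/negP; rewrite negb_or => /andP[nab' na'b].
have h1 : H a b by case/andP: hab.
have h2 : H a' b' by case/andP: hab'.
have h12 : H a b'.
  apply/negPn/negP => n12; have [n21|n21] := boolP (H a' b); last first.
    have K : conflict (a, b) (a', b') by rewrite /conflict /= h1 h2 n12 n21.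
    apply: (no_conflict _ _ hab K); apply: (colour_of _ (a, b) hab').
    by rewrite conflict_sym.
  by case/negP: na'b; apply: (one_missing _ _ _ _ hab' hab).
have h21 : H a' b.
  apply/negPn/negP => n21.
  by case/negP: nab'; apply: (one_missing _ _ _ _ hab hab').
(* Now ab' and a'b are both edges, kept out of the half by conflicts with a1b1 and a2b2 of colour
   x. *)
have [a1 [b1 [h11 n1 n1' cx1]]] := conflict_of _ _ h12 nab'.
have [a2 [b2 [h22 n2 n2' cx2]]] := conflict_of _ _ h21 na'b.
have a1b : H a1 b.
  apply/negPn/negP => n; apply: (no_conflict _ (a1, b1) hab) => //.
  by rewrite /conflict /= h1 h11 n n1.
have a'b1 : H a' b1.
  apply/negPn/negP => n; apply: (no_conflict _ (a1, b1) hab') => //.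
  by rewrite /conflict /= h2 h11 n n1'.
have ab2 : H a b2.
  apply/negPn/negP => n; apply: (no_conflict _ (a2, b2) hab) => //.
  by rewrite /conflict /= h1 h22 n n2'.
have a2b' : H a2 b'.
  apply/negPn/negP => n; apply: (no_conflict _ (a2, b2) hab') => //.
  by rewrite /conflict /= h2 h22 n n2.
clear nab' na'b conflict_of one_missing.
(* One of a1b2 and a2b1 is an edge, since a1b1 and a2b2 have the same colour and cannot conflict;
   the situation is symmetric. *)
wlog a1b2 : a b a' b' a1 b1 a2 b2 hab hab' h1 h2 h12 h21 h11 n1 n1' cx1
    h22 n2 n2' cx2 a1b a'b1 ab2 a2b' / H a1 b2 => [Hw|].
  have [a1b2|n] := boolP (H a1 b2); first exact: (Hw a b a' b' a1 b1 a2 b2).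
  apply: (Hw a' b' a b a2 b2 a1 b1) => //; apply/negPn/negP => n'.
  have := cP (a1, b1) (a2, b2); rewrite /conflict /= h11 h22 n n' cx1 cx2.
  by move=> /(_ isT); case: (x).
have c_a'b' : c (a', b') = x.
  by apply: (colour_of _ (a1, b2) hab'); rewrite /conflict /= h2 a1b2 n2 n1'.
have c_a1b2 : c (a1, b2) = ~~ x.
  by rewrite (cP _ (a', b')) ?c_a'b' // /conflict /= h2 a1b2 n2 n1'.
have c_ab' : c (a, b') = ~~ x.
  by rewrite (cP _ (a1, b1)) ?cx1 // /conflict /= h12 h11 n1 n1'.
(* Otherwise ab', a1b2 and a'b1 all have the colour other than x and alternate on a hexagon. *)
have c_a'b1 : c (a', b1) = x.
  apply/eqP/negPn/negP => nx; apply: (no_hex a a1 a' b1 b' b2); split.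
  1-3: by rewrite ?n1 ?n1' ?n2 ?h12 ?a1b2 ?a'b1 ?ab2 ?h11 ?h2.
  by move: nx; rewrite c_ab' c_a1b2; case: (c _); case: (x).
have [a2b1|a2b1] := boolP (H a2 b1); last first.
  have := cP (a', b1) (a2, b2); rewrite /conflict /= a'b1 h22 n2 a2b1.
  by move=> /(_ isT); rewrite c_a'b1 cx2; case: (x).
have c_ab : c (a, b) = x.
  by apply: (colour_of _ (a2, b1) hab); rewrite /conflict /= h1 a2b1 n1 n2'.
apply: (no_hex a a2 a' b1 b b2); split; last by rewrite c_ab cx2 c_a'b1.
all: by rewrite ?n1 ?n2' ?n2 ?h1 ?h22 ?a'b1 ?ab2 ?a2b1 ?h21.
Qed.

End TwoChains.

(** * Threshold representation of chain graphs *)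

Section Thresholds.
Variables (U V : finType) (H : U -> V -> bool).

(** Take the degree of a, and for b the number of vertices whose neighbourhood contains that of b.
    The latter set lies inside N(a) if ab is an edge; otherwise, by the chain condition, it contains
    N(a) and also b. *)
Lemma chain_thresholds :
    (forall a b a' b', H a b -> H a' b' -> H a b' || H a' b) ->
  exists (f : U -> nat) (g : V -> nat),
    [/\ forall a, f a <= #|V|, forall b, 0 < g b <= #|V| &
        forall a b, H a b = (g b <= f a)].
Proof.
move=> chain; pose N a := [set b | H a b].
pose M b := [set b' | [forall a, H a b ==> H a b']].
exists (fun a => #|N a|), (fun b => #|M b|); split=> [a|b|a b].
- exact: max_card.
- rewrite max_card andbT card_gt0; apply/set0Pn; exists b.
  by rewrite inE; apply/forallP => a; apply/implyP.
apply/idP/idP => [hab|].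
  apply/subset_leq_card/subsetP => b'; rewrite !inE => /forallP/(_ a).
  by rewrite hab.
rewrite leqNgt; apply: contraR => nab; apply: proper_card; apply/properP.
split; last first.
  by exists b; rewrite !inE //; apply/forallP => a'; apply/implyP.
apply/subsetP => b'; rewrite !inE => hab'; apply/forallP => a'.
by apply/implyP => ha'b; have := chain _ _ _ _ hab' ha'b; rewrite (negPf nab).
Qed.

End Thresholds.

Lemma two_colourable_thresholds (U V : finType) (H : U -> V -> bool) c :
    proper_colouring H c ->
  exists (f1 f2 : U -> nat) (g1 g2 : V -> nat),
    [/\ forall a, (f1 a <= #|V|) && (f2 a <= #|V|),
        forall b, (0 < g1 b <= #|V|) && (0 < g2 b <= #|V|) &
        forall a b, H a b = (g1 b <= f1 a) || (g2 b <= f2 a)].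
Proof.
move=> cP; have lP := lex_colouring_proper cP; set l := lex_colouring H c in lP.
have chain x a b a' b' : half H l x (a, b) -> half H l x (a', b') ->
    half H l x (a, b') || half H l x (a', b).
  by apply: half_chain => // *; apply: lex_colouring_hexagon.
have [f1 [g1 [f1n g1n H1]]] :=
  @chain_thresholds U V (fun a b => half H l true (a, b)) (chain true).
have [f2 [g2 [f2n g2n H2]]] :=
  @chain_thresholds U V (fun a b => half H l false (a, b)) (chain false).
exists f1, f2, g1, g2; split=> [a|b|a b].
- by rewrite f1n f2n.
- by rewrite g1n g2n.
by rewrite -H1 -H2; exact: (half_cover (a, b) lP).
Qed.

(** * Cyclic orientation of induced 4-cycles *)

Section Orientations.
Variables (T : finType) (e : rel T).
Hypothesis e_simple : simple_graph e.

Lemma card_set_in_seq (c : seq T) (p : pred T) :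
  uniq c -> #|[set y in c | p y]| = count p c.
Proof.
move=> Uc; rewrite cardsE -size_filter -(card_uniqP (filter_uniq p Uc)).
by apply: eq_card => y; rewrite mem_filter andbC.
Qed.

Lemma cyclically_oriented4 (d : rel T) p q r s :
    uniq [:: p; q; r; s] -> orientation e d -> ~~ e p r -> ~~ e q s ->
  cyclically_oriented d [:: p; q; r; s] <->
    [/\ d p q (+) d p s, d q p (+) d q r, d r q (+) d r s & d s p (+) d s r].
Proof.
case: e_simple => e_sym e_irr Uc [d_e _] npr nqs.
have d0 x y : ~~ e x y -> d x y = false.
  by move=> nxy; apply/negP => /d_e; rewrite (negPf nxy).
have dxx x : d x x = false by rewrite d0 ?e_irr.
have [dpr drp] : d p r = false /\ d r p = false by rewrite !d0 // e_sym.
have [dqs dsq] : d q s = false /\ d s q = false by rewrite !d0 // e_sym.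
have xorP (b b' : bool) : (b + (b' + 0) = 1)%N <-> b (+) b'.
  by case: b; case: b'.
split=> [cyc|[hp hq hr hs] x xc].
  split; [have := cyc p|have := cyc q|have := cyc r|have := cyc s];
  rewrite !inE eqxx ?orbT => /(_ isT); rewrite card_set_in_seq //=;
  rewrite ?dxx ?dpr ?drp ?dqs ?dsq /= ?add0n; by move/xorP.
rewrite /= card_set_in_seq //; move: xc; rewrite !inE => /or4P[] /eqP-> /=;
  rewrite ?dxx ?dpr ?drp ?dqs ?dsq /= ?add0n; exact/xorP.
Qed.

Lemma induced_cycle4 c : induced_cycle e c -> size c = 4 ->
  exists p q r s, [/\ c = [:: p; q; r; s], uniq c,
    [/\ e p q, e q r, e r s & e s p] & ~~ e p r /\ ~~ e q s].
Proof.
case: c => [|p [|q [|r [|s []]]]] //= [_ /andP[cyc Uc] chordless] _.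
exists p, q, r, s; split=> //.
  by move: cyc; rewrite /= andbT => /and4P[].
move: (Uc); rewrite /= !inE !negb_or andbT.
case/and3P=> /and3P[pq pr ps] /andP[qr qs] rs.
have neq := (eq_sym q p, eq_sym r p, eq_sym r q, eq_sym s p, eq_sym s q,
  eq_sym s r, negPf pq, negPf pr, negPf ps, negPf qr, negPf qs, negPf rs).
split; apply/negP => h.
  have := chordless p r; rewrite !inE !eqxx ?orbT => /(_ isT isT h) /=.
  by rewrite !(eqxx, neq) /= ?neq.
have := chordless q s; rewrite !inE !eqxx ?orbT => /(_ isT isT h) /=.
by rewrite !(eqxx, neq) /= ?neq.
Qed.

Lemma induced_cycle4_build p q r s :
    uniq [:: p; q; r; s] -> [/\ e p q, e q r, e r s & e s p] ->
    ~~ e p r -> ~~ e q s ->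
  induced_cycle e [:: p; q; r; s].
Proof.
case: e_simple => e_sym e_irr Uc [pq qr rs sp] npr nqs.
split=> //; first by rewrite /ucycle Uc /= pq qr rs sp.
have nrp : ~~ e r p by rewrite e_sym.
have nsq : ~~ e s q by rewrite e_sym.
move: (Uc); rewrite /= !inE !negb_or andbT.
case/and3P=> /and3P[Npq Npr Nps] /andP[Nqr Nqs] Nrs.
have neq := (eq_sym q p, eq_sym r p, eq_sym r q, eq_sym s p, eq_sym s q,
  eq_sym s r, negPf Npq, negPf Npr, negPf Nps, negPf Nqr, negPf Nqs, negPf Nrs).
move=> x y; rewrite !inE => /or4P[] /eqP-> /or4P[] /eqP-> /=.
all: rewrite ?e_irr ?(negPf npr) ?(negPf nqs) ?(negPf nrp) ?(negPf nsq) //.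
all: by rewrite ?(eqxx, neq) ?orbT.
Qed.

(** The two cycle neighbours of a vertex are not adjacent, so it has at most one out-neighbour on
    the cycle; four edges over four vertices then force exactly one each. *)
Lemma one_perfect_C4 :
  one_perfectly_orientable e -> induced_C4_cyclically_orientable e.
Proof.
case: e_simple => e_sym _ [d [d_or d_cl]]; exists d; split=> // c c_ind c4.
have [p [q [r [s [-> Uc [pq qr rs sp] [npr nqs]]]]]] := induced_cycle4 c_ind c4.
apply/cyclically_oriented4 => //; case: d_or => _ d_xor.
have nout x y z : y != z -> ~~ e y z -> ~~ (d x y && d x z).
  move=> yz nyz; apply/negP => /andP[xy xz].
  by move: nyz; rewrite (d_cl x y z) // inE.
move: (Uc); rewrite /= !inE !negb_or andbT.
case/and3P=> /and3P[Npq Npr Nps] /andP[Nqr Nqs] Nrs.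
have := nout p _ _ Nqs nqs; have := nout q _ _ Npr npr.
have := nout r _ _ Nqs nqs; have := nout s _ _ Npr npr.
have := d_xor _ _ pq; have := d_xor _ _ qr.
have := d_xor _ _ rs; have := d_xor _ _ sp.
case: (d p q); case: (d q p); case: (d q r); case: (d r q); case: (d r s);
  case: (d s r); case: (d s p); case: (d p s) => //=; by split.
Qed.

End Orientations.

(** * From orientations to colourings of the cross edges *)

Section CoBipartite.
Variables (T : finType) (e : rel T) (A : {set T}).
Hypothesis e_simple : simple_graph e.
Hypothesis e_cobip :
  forall x y, complement e x y -> (x \in A) != (y \in A).

Definition cross_edge a b := [&& a \in A, b \notin A & e a b].

Lemma same_side_edge x y : x != y -> (x \in A) = (y \in A) -> e x y.
Proof.
move=> Nxy xyA; apply/negPn/negP => nxy.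
by have := @e_cobip x y; rewrite /complement Nxy nxy xyA eqxx => /(_ isT).
Qed.

Lemma orientation_colouring d :
    orientation e d ->
    (forall c, induced_cycle e c -> size c = 4 -> cyclically_oriented d c) ->
  proper_colouring cross_edge (fun f => d f.1 f.2).
Proof.
case: e_simple => e_sym e_irr d_or d_cyc [a b] [a' b'] /and4P[/=].
move=> /and3P[aA bA ab] /and3P[a'A b'A a'b'].
rewrite /cross_edge aA a'A bA b'A /= => nab' na'b.
have Naa' : a != a' by apply: contraNneq nab' => ->.
have Nbb' : b != b' by apply: contraNneq nab' => <-.
have AB x y : x \in A -> y \notin A -> (x != y) /\ (y != x).
  by move=> xA yA; rewrite (eq_sym y); split; apply: contraNneq yA => <-.
have [Nab Nba] := AB _ _ aA bA; have [Nab' Nb'a] := AB _ _ aA b'A.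
have [Na'b Nba'] := AB _ _ a'A bA; have [Na'b' Nb'a'] := AB _ _ a'A b'A.
have aa' : e a' a by apply: same_side_edge; rewrite ?aA ?a'A // eq_sym.
have bb' : e b b'.
  by apply: same_side_edge => //; rewrite (negPf bA) (negPf b'A).
(* The clique edges bb' and a'a close the two conflicting cross edges to an induced 4-cycle. *)
have Uc : uniq [:: a; b; b'; a'].
  by rewrite /= !inE !negb_or Nab Nab' Naa' Nbb' Nba' Nb'a'.
have nba' : ~~ e b a' by rewrite e_sym.
have b'a' : e b' a' by rewrite e_sym.
have := d_cyc _ (induced_cycle4_build e_simple Uc _ nab' nba') erefl.
move=> /(_ (And4 ab bb' b'a' aa')).
case/(cyclically_oriented4 e_simple Uc d_or nab' nba').
case: d_or => _ d_xor; have := d_xor _ _ ab; have := d_xor _ _ bb'.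
have := d_xor _ _ b'a'; have := d_xor _ _ aa'.
case: (d a b); case: (d b a); case: (d b b'); case: (d b' b); case: (d b' a');
  by case: (d a' b'); case: (d a a'); case: (d a' a).
Qed.

End CoBipartite.

From mathcomp Require Import classical_sets reals trigo boolp.
From mathcomp Require Import lra ring.
Import Order.TTheory GRing.Theory Num.Theory.

(** * Circular arcs: orienting their intersection graphs and building models *)

Section Circle.
Local Open Scope ring_scope.
Local Open Scope classical_set_scope.
Variable R : realType.
Implicit Types t s u : R.

Definition arc (a b : R) := @circle_point R @` [set t | a <= t <= b].

Lemma circle_pointD t s u :
  circle_point t = circle_point s -> circle_point (t + u) = circle_point (s + u).
Proof. by case=> ct st; rewrite /circle_point !cosD !sinD ct st. Qed.

(** Moving forward from a common point, whichever arc ends first ends inside the other. *)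
Lemma arcs_meet (a b a' b' : R) : arc a b `&` arc a' b' !=set0 ->
  arc a b (circle_point b') \/ arc a' b' (circle_point b).
Proof.
case=> _ [[t /= t_ab <-] [s /= s_ab ts]].
have [le|lt] := leP (b - t) (b' - s); [right|left].
  exists (s + (b - t)); first by rewrite /=; lra.
  by rewrite (circle_pointD _ ts); congr circle_point; ring.
exists (t + (b' - s)); first by rewrite /=; lra.
by rewrite (circle_pointD _ (esym ts)); congr circle_point; ring.
Qed.

(* An edge is directed towards an arc containing the end of the other one, so
   all out-neighbours of a vertex share a point. *)
Lemma circular_arc_one_perfect (T : finType) (e : rel T) :
  simple_graph e -> circular_arc_graph R e -> one_perfectly_orientable e.
Proof.
move=> [e_sym e_irr] [S [S_arc S_e]].
pose end_of x p := exists a b, [/\ a <= b, S x = arc a b & p = circle_point b].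
have [p p_end] : {p : T -> R * R & forall x, end_of x (p x)}.
  apply: choice => x; have [a [b [ab Sx]]] := S_arc x.
  by exists (circle_point b), a, b.
pose h x y := e x y && `[< S y (p x) >].
(* The rank breaks the tie when each arc contains the chosen end of the other. *)
exists (fun x y => h x y && (~~ h y x || (enum_rank x < enum_rank y)%N)).
split; last first.
  move=> v x y; rewrite !inE => /andP[/andP[_ /asboolP Sx] _].
  move=> /andP[/andP[_ /asboolP Sy] _] xy.
  by apply/(S_e _ _ xy); exists (p v).
split=> [x y /andP[/andP[]] //|x y exy].
have Nxy : x != y by apply: contraTneq exy => ->; rewrite e_irr.
have : h x y || h y x.
  rewrite /h (e_sym y x) exy /=.
  have /(S_e _ _ Nxy) := exy.
  have [a [b [ab Sx px]]] := p_end x; have [a' [b' [ab' Sy py]]] := p_end y.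
  rewrite Sx Sy => /arcs_meet; rewrite -px -py -Sx -Sy => -[Sxy|Syx].
    by apply/orP; right; apply/asboolP.
  by apply/orP; left; apply/asboolP.
have : (enum_rank x != enum_rank y :> nat).
  by apply: contra Nxy => /eqP/val_inj/enum_rank_inj->.
by case: (h x y); case: (h y x) => //=; case: ltngtP.
Qed.

Lemma cos_lt1 t : 0 < t < pi *+ 2 -> cos t != 1.
Proof.
move=> t0; have -> : t = (t / 2) *+ 2 by rewrite mulr2n; field.
have : 0 < sin (t / 2).
  by apply: sin_gt0_pi; move: t0; rewrite mulr2n; lra.
rewrite cos_mulr2n cos2sin2 => s0; apply/eqP => eq1.
have : sin (t / 2) ^+ 2 = 0 by lra.
by move/eqP; rewrite sqrf_eq0 gt_eqF.
Qed.

(** If r < m and l < n, angles t and s on the two arcs differ by an amount strictly between 0 and 2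
    pi, while a common point would give cos (s - t) = 1. *)
Lemma opposite_arcs_meet (l r m n : R) :
    0 <= l < pi -> 0 <= r < pi -> 0 < m < pi -> 0 < n < pi ->
  arc (- l) r `&` arc m (pi *+ 2 - n) !=set0 <-> m <= r \/ n <= l.
Proof.
move=> Hl Hr Hm Hn; split=> [[_ [[t /= Ht <-] [s /= Hs [cs ss]]]]|].
  have [mr|rm] := leP m r; first by left.
  have [nl|ln] := leP n l; first by right.
  have /eqP[] : cos (s - t) != 1.
    by apply: cos_lt1; move: Hs; rewrite mulr2n; lra.
  by rewrite cosB cs ss -!expr2 cos2Dsin2.
case=> [mr|nl].
  exists (circle_point m); split; exists m => //=; first by lra.
  by rewrite mulr2n; lra.
exists (circle_point (- n)); split; first by exists (- n) => //=; lra.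
exists (pi *+ 2 - n); first by rewrite /= mulr2n; lra.
by rewrite /circle_point addrC cosD2pi sinD2pi.
Qed.

Lemma colouring_circular_arc (T : finType) (e : rel T) (A : {set T}) c :
    simple_graph e ->
    (forall x y, complement e x y -> (x \in A) != (y \in A)) ->
    proper_colouring (cross_edge e A) c ->
  circular_arc_graph R e.
Proof.
move=> [e_sym e_irr] e_cobip /two_colourable_thresholds.
case=> f1 [f2 [g1 [g2 [f_bd g_bd cross]]]].
(* Thresholds are at most #|T|; the successor in the denominator keeps their angles strictly below
   pi. *)
pose angle k : R := pi * (k%:R / #|T|.+1%:R).
have pi0 := pi_gt0 R.
have angle_lt k : (k <= #|T|)%N -> angle k < pi.
  move=> kn; rewrite gtr_pMr // ltr_pdivrMr ?ltr0n // mul1r ltr_nat ltnS //.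
have angle_le j k : (angle j <= angle k) = (j <= k)%N.
  by rewrite ler_pM2l // ler_pM2r ?invr_gt0 ?ltr0n // ler_nat.
have angle0 : angle 0 = 0 by rewrite /angle mul0r mulr0.
have angle_ge k : 0 <= angle k by rewrite -angle0 angle_le.
have angle_gt k : (0 < k)%N -> 0 < angle k.
  by rewrite -angle0 ltNge angle_le -ltnNge.
have f1P (a : T) : 0 <= angle (f1 a) < pi.
  by rewrite angle_ge angle_lt //; case/andP: (f_bd a).
have f2P (a : T) : 0 <= angle (f2 a) < pi.
  by rewrite angle_ge angle_lt //; case/andP: (f_bd a).
have g1P (b : T) : 0 < angle (g1 b) < pi.
  by case/andP: (g_bd b) => /andP[? ?] _; rewrite angle_gt ?angle_lt.
have g2P (b : T) : 0 < angle (g2 b) < pi.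
  by case/andP: (g_bd b) => _ /andP[? ?]; rewrite angle_gt ?angle_lt.
(* The first chain graph is realised at angles between 0 and pi, the second between -pi and 0. *)
pose lo x := if x \in A then - angle (f2 x) else angle (g1 x).
pose hi x := if x \in A then angle (f1 x) else pi *+ 2 - angle (g2 x).
have arc_cross (a b : T) : a \in A -> b \notin A ->
    e a b <-> arc (lo a) (hi a) `&` arc (lo b) (hi b) !=set0.
  move=> aA bA; have := cross a b; rewrite /cross_edge aA bA /= => ->.
  rewrite /lo /hi aA (negPf bA) opposite_arcs_meet // !angle_le.
  by split=> /orP.
exists (fun x => arc (lo x) (hi x)); split=> [x|x y Nxy].
  exists (lo x), (hi x); split=> //; rewrite /lo /hi.
  have := (f1P x, f2P x, g1P x, g2P x).
  case: ifP => _ [[[? ?] ?] ?]; last rewrite mulr2n; lra.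
case xA: (x \in A); case yA: (y \in A).
- split=> [_|_]; last by apply: (same_side_edge e_cobip); rewrite // xA yA.
  exists (circle_point 0); rewrite /lo /hi xA yA.
  have := (f1P x, f2P x, f1P y, f2P y) => -[[[? ?] ?] ?].
  by split; exists 0 => //=; lra.
- by apply: arc_cross; rewrite ?yA.
- by rewrite e_sym setIC; apply: arc_cross; rewrite ?xA.
split=> [_|_]; last by apply: (same_side_edge e_cobip); rewrite // xA yA.
exists (circle_point pi); rewrite /lo /hi xA yA.
have := (g1P x, g2P x, g1P y, g2P y) => -[[[? ?] ?] ?].
by split; exists pi => //=; rewrite mulr2n; lra.
Qed.

End Circle.

Theorem theorem10 (R : realType) (T : finType) (e : rel T)
  (e_simple : simple_graph e) (e_cobip : co_bipartite e) :
  (one_perfectly_orientable e <-> induced_C4_cyclically_orientable e) /\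
  (induced_C4_cyclically_orientable e <-> circular_arc_graph R e).
Proof.
have C4_arc : induced_C4_cyclically_orientable e -> circular_arc_graph R e.
  case: e_cobip => A A_cobip [d [d_or d_cyc]].
  apply: (colouring_circular_arc R e_simple A_cobip).
  exact: orientation_colouring d_or d_cyc.
have arc_perfect := @circular_arc_one_perfect R T e e_simple.
have perfect_C4 := one_perfect_C4 e_simple.
by split; split=> h; auto.
Qed.
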